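(* Let $G$ be a connected central topological group. Then $G$ admits a transversal group topology if and only if $G$ is not compact.
   Context: All topological groups are Hausdorff. Two non-discrete Hausdorff group topologies $\tau,\delta$ on a group $G$ are called transversal if their least upper bound $\tau\vee\delta$ is the discrete topology. A topological group $(G,\tau)$ admits a transversal group topology if there is a group topology $\delta$ on $G$ such that $\tau$ and $\delta$ are transversal. A locally compact topological group $G$ is a central topological group if $G/Z(G)$ is compact, where $Z(G)$ is the center of $G$. *)

(* Defs.v *)
From HB Require Import structures.
From mathcomp Require Import all_boot all_classical topology.

Set Implicit Arguments.
Unset Strict Implicit.
Unset Printing Implicit Defensive.

Import Algebra.

Local Open Scope classical_set_scope.
Local Open Scope quotient_scope.
Local Open Scope group_scope.

(* Several topologies live on one group, so a topology is carried as data
   [tau : Topological G] rather than inferred from the carrier; [space tau] is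
   the topological space with carrier [G] and topology [tau]. *)
Definition space (T : Type) (tau : Topological T) : topologicalType :=
  Topological.Pack tau.

Definition group_topology (G : groupType) (tau : Topological G) : Prop :=
  [/\ continuous (fun p : space tau * space tau =>
        ((p.1 : G) * (p.2 : G) : space tau)),
      continuous (fun x : space tau => ((x : G)^-1 : space tau))
    & hausdorff_space (space tau)].

Definition discrete (T : topologicalType) : Prop := forall A : set T, open A.

Definition topology_join (T : choiceType) (tau delta : Topological T)
    : topologicalType :=
  sup_topology (fun b : bool => if b then tau else delta).

Definition transversal (G : groupType) (tau delta : Topological G) : Prop :=
  [/\ group_topology tau /\ ~ discrete (space tau),
      group_topology delta /\ ~ discrete (space delta)
    & discrete (topology_join tau delta)].

Definition admits_transversal (G : groupType) (tau : Topological G) : Prop :=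
  exists delta : Topological G, transversal tau delta.

Definition center (G : groupType) : set G :=
  [set z | forall x : G, commute z x].

Section CenterQuotient.
Variables (G : groupType) (tau : Topological G).

Definition center_coset : rel (space tau) :=
  fun x y => `[< center ((x : G)^-1 * (y : G)) >].

Lemma center_coset_refl : reflexive center_coset.
Proof. by move=> x; apply/asboolP => y; rewrite /commute mulVg mul1g mulg1. Qed.

Let commute_inv (z x : G) : commute z x -> commute z^-1 x.
Proof.
by move=> zx; apply: (mulgI z); rewrite mulgA mulgV mul1g mulgA zx -mulgA mulgV mulg1.
Qed.

Lemma center_coset_sym : symmetric center_coset.
Proof.
suff h (x y : space tau) : center_coset x y -> center_coset y x.
  by move=> x y; apply/idP/idP; exact: h.
move=> /asboolP xy; apply/asboolP => w.
by have := commute_inv (xy w); rewrite invgM invgK.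
Qed.

Lemma center_coset_trans : transitive center_coset.
Proof.
move=> y x z /asboolP xy /asboolP yz; apply/asboolP => w.
have -> : (x : G)^-1 * (z : G) = ((x : G)^-1 * (y : G)) * ((y : G)^-1 * (z : G)).
  by rewrite mulgA -[_ * _ * (y : G)^-1]mulgA mulgV mulg1.
apply: commute_sym; apply: commuteM; apply: commute_sym; [exact: xy|exact: yz].
Qed.

Canonical center_coset_equiv :=
  EquivRel center_coset center_coset_refl center_coset_sym center_coset_trans.

Definition center_quotient : topologicalType :=
  quotient_topology {eq_quot center_coset}.

End CenterQuotient.

Definition central_group (G : groupType) (tau : Topological G) : Prop :=
  [/\ group_topology tau, locally_compact [set: space tau]
    & compact [set: center_quotient tau]].

(* Main.v *)
From HB Require Import structures.
From mathcomp Require Import all_boot all_classical topology.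
Require Import Defs.

(** The obstruction to a transversal topology on a compact group is a pigeonhole
argument. If tau and delta are transversal, then some neighbourhoods U and V of
1 meet only at 1. Finitely many tau-small translates cover the compact group,
and each of them contains at most one point of a delta-small set
([transversal_not_compact]). So 1 has a finite delta-neighbourhood, and a
Hausdorff group topology with that property is discrete.

For the converse, a central element f that generates an infinite subgroup,
discrete for tau, is enough: the subgroups generated by f ^+ (2 ^ n) are the
neighbourhoods of 1 for a Hausdorff group topology, which is not discrete, and
a tau-neighbourhood of 1 that misses the nontrivial powers of f makes the join
discrete ([admits_transversal_of_sparse_central]). Centrality is what makes
these subgroups a basis at 1 of a group topology on the whole of G.

To find f, compactness modulo the center gives a compact neighbourhood C of 1
whose central translates cover G. The compact set C * C is then covered by
finitely many translates z * C with z central. If P is the set of products of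
powers of these z, then P * C is stable under right multiplication by C, hence
open and closed, hence equal to G by connectedness
([connected_central_generation]). In a locally compact group the powers of an
element either avoid a neighbourhood of 1 or lie in a compact set
([powers_sparse_or_bounded]). If the second case held for each z, then P, and
G = P * C with it, would lie in a compact set. So G not compact provides a z in
the first case. *)

Set Implicit Arguments.
Unset Strict Implicit.
Unset Printing Implicit Defensive.

Import Algebra.

Local Open Scope classical_set_scope.
Local Open Scope quotient_scope.
Local Open Scope group_scope.

(** * Compactness and neighbourhoods *)

(** If no finite subfamily covers A, then the complements in A of the finite
unions form a base of a proper filter that clusters at no point of A. *)
Lemma compact_nbhs_cover (T : topologicalType) (A : set T) (I : choiceType)
    (D : set I) (f : I -> set T) :
  compact A -> (forall x, A x -> exists2 i, D i & nbhs x (f i)) ->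
  exists2 s : seq I, {in s, forall i, D i} &
    forall x, A x -> exists2 i, i \in s & f i x.
Proof.
move=> Aco Af.
pose F := filter_from [set s : seq I | {in s, forall i, D i}]
  (fun s => A `\` [set x | exists2 i, i \in s & f i x]).
have FF : Filter F.
  apply: filter_from_filter; first by exists [::].
  move=> s t sD tD; exists (s ++ t).
    by move=> i; rewrite mem_cat => /orP[/sD|/tD].
  move=> x [Ax nst]; split; split=> // -[i ist fx]; apply: nst;
    by exists i => //; rewrite mem_cat ist ?orbT.
apply: contrapT => ncover.
have PF : ProperFilter F.
  apply: filter_from_proper => s sD.
  apply/set0P/eqP => /seteqP[Ds _]; apply: ncover; exists s => // x Ax.
  by apply: contrapT => nx; exact: (Ds x).
have [|p [Ap clp]] := Aco F PF; first by exists [::] => // x [].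
have [i Di fp] := Af p Ap.
have [|y [[_ ny] fy]] :=
    clp (A `\` [set x | exists2 j, j \in [:: i] & f j x]) _ _ fp.
  by exists [:: i] => // j; rewrite inE => /eqP ->.
by apply: ny; exists i => //; rewrite inE.
Qed.

Lemma locally_compact_nbhs (T : topologicalType) (x : T) :
  locally_compact [set: T] -> exists2 K : set T, nbhs x K & compact K.
Proof.
move=> /(_ x I)[K Kx [cK _]]; exists K => //.
by apply: (@filterS _ _ (nbhs_filter x) [set y | True -> K y]) Kx => y; exact.
Qed.

(** * Neighbourhoods in a topological group *)

Section GroupNeighbourhoods.
Variables (G : groupType) (tau : Topological G).
Hypothesis tg : group_topology tau.
Local Notation nb x A := (nbhs (x : space tau) A).
Implicit Types (x y a : G) (U A B : set G).

Lemma nbhs_mulg x y U : nb (x * y) U ->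
  exists V W, [/\ nb x V, nb y W & forall a b, V a -> W b -> U (a * b)].
Proof.
case: tg => mc _ _ /(mc (x, y))[[V W] [/= Vx Wy] VWU].
by exists V, W; split=> // a b Va Wb; apply: (VWU (a, b)).
Qed.

Lemma nbhs_invg x U : nb x^-1 U -> nb x [set y | U y^-1].
Proof. by case: tg => _ ic _ /ic. Qed.

Lemma nbhs_mulgl a x U : nb (a * x) U -> nb x [set y | U (a * y)].
Proof.
move=> /nbhs_mulg[V [W [/(@nbhs_singleton (space tau)) Va Wx VW]]].
by apply: filterS Wx => y; exact: VW.
Qed.

Lemma nbhs_mulgr a x U : nb (x * a) U -> nb x [set y | U (y * a)].
Proof.
move=> /nbhs_mulg[V [W [Vx /(@nbhs_singleton (space tau)) Wa VW]]].
by apply: filterS Vx => y Vy; exact: VW.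
Qed.

Lemma nbhs_translate x U : nb 1 U -> nb x [set y | U (x^-1 * y)].
Proof. by move=> U1; apply: nbhs_mulgl; rewrite mulVg. Qed.

Lemma nbhs1_divl U : nb 1 U ->
  exists2 V, nb 1 V & forall a b, V a -> V b -> U (a^-1 * b).
Proof.
move=> U1; have : nb (1^-1 * 1) U by rewrite mulVg.
move=> /nbhs_mulg[V [W [V1 W1 VW]]].
exists ([set a | V a^-1] `&` W) => [|a b [Va _] [_ Wb]]; last exact: VW.
by apply: filterI => //; exact: nbhs_invg.
Qed.

Lemma nbhs1_expg n U : nb 1 U -> nb 1 [set y | U (y ^+ n)].
Proof.
elim: n U => [|n IHn] U U1.
  have U1' := nbhs_singleton U1.
  by apply: filterE => y /=; rewrite expg0.
have : nb (1 * 1) U by rewrite mulg1.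
move=> /nbhs_mulg[V [W [V1 /IHn W1 VW]]].
by apply: filterS2 V1 W1 => y Vy Wy /=; rewrite expgS; exact: VW.
Qed.

Lemma compact_mulg A B : compact (A : set (space tau)) ->
  compact (B : set (space tau)) ->
  compact ([set a * b | a in A & b in B] : set (space tau)).
Proof.
move=> cA cB; case: tg => mc _ _.
have -> : [set a * b | a in A & b in B] = (fun p => p.1 * p.2) @` (A `*` B).
  apply/seteqP; split=> [_ [a Aa [b Bb <-]]|_ [[a b] [/= Aa Bb] <-]].
    by exists (a, b).
  by exists a => //; exists b.
apply: (@continuous_compact (space tau * space tau)%type (space tau)).
  exact: continuous_subspaceT.
exact: compact_setX.
Qed.

Lemma compact_translate a A : compact (A : set (space tau)) ->
  compact ([set x | A (a * x)] : set (space tau)).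
Proof.
move=> cA; have -> : [set x | A (a * x)] = [set b * c | b in [set a^-1] & c in A].
  apply/seteqP; split=> [x Ax|_ [_ -> [c Ac <-]]]; last by rewrite /= mulVKg.
  by exists a^-1 => //; exists (a * x) => //; rewrite mulKg.
by apply: compact_mulg => //; exact: (@compact_set1 (space tau)).
Qed.

Lemma nonisolated1 : ~ discrete (space tau) -> ~ nb 1 [set 1].
Proof.
move=> nd i1; apply: nd => A; rewrite openE => x Ax.
rewrite /interior; apply: filterS (nbhs_translate x i1) => y /= xy.
by have <- : x = y by rewrite -[x]mulg1 -xy mulVKg.
Qed.

(** Points are closed, so a finite neighbourhood of 1 can be cut down to 1. *)
Lemma finite_nbhs_discrete V : nb 1 V -> finite_set V -> nb 1 [set 1].
Proof.
move=> V1 fV; have : closed (V `\ 1 : set (space tau)).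
  have [h _] := @accessible_finite_set_closed (space tau).
  apply: h; last exact: finite_setD.
  by apply: hausdorff_accessible; case: tg.
move=> /closed_openC; rewrite openE => /(_ (1 : space tau)) h.
have {}/h h : (~` (V `\ 1) : set (space tau)) 1 by move=> [_]; apply.
by apply: filterS2 V1 h => y Vy ny; apply: contrapT => y1; exact: ny.
Qed.

End GroupNeighbourhoods.

(** The join is the coarsest topology finer than tau and delta, so the filter
generated by the sets U `&` V, which converges to x for tau and for delta,
converges to x for the join. *)
Lemma nbhs_join (G : groupType) (tau delta : Topological G) (x : G)
    (A : set G) :
  nbhs (x : topology_join tau delta) A <->
  exists U V, [/\ nbhs (x : space tau) U, nbhs (x : space delta) V
    & U `&` V `<=` A].
Proof.
set Tc := fun b : bool => if b then tau else delta.
pose F := filter_from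
  [set p : set G * set G | nbhs (x : space tau) p.1 /\ nbhs (x : space delta) p.2]
  (fun p => p.1 `&` p.2).
have FF : Filter F.
  apply: filter_from_filter; first by exists (setT, setT); split; exact: filterT.
  move=> [U V] [U' V'] [/= Ux Vx] [/= U'x V'x].
  exists (U `&` U', V `&` V'); first by split; exact: filterI.
  by move=> y [[? ?] [? ?]].
split=> [|[U [V [Ux Vx UVA]]]].
  have /(_ A) h : F --> (x : sup_topology Tc).
    apply/cvg_sup => -[] U Ux.
      by exists (U, setT); [split=> //; exact: filterT | move=> y []].
    by exists (setT, U); [split=> //; exact: filterT | move=> y []].
  by move=> /h [[U V] [/= Ux Vx] UVA]; exists U, V.
have h b : nbhs (x : sup_topology Tc) --> (x : space (Tc b)).
  by move: b; apply/cvg_sup; exact: cvg_id.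
have hU : nbhs (x : sup_topology Tc) U by exact: (h true U Ux).
have hV : nbhs (x : sup_topology Tc) V by exact: (h false V Vx).
have hUV := @filterI _ _ (nbhs_filter (x : sup_topology Tc)) _ _ hU hV.
exact: (@filterS _ _ (nbhs_filter (x : sup_topology Tc)) _ _ UVA hUV).
Qed.

(** * Compact groups have no transversal topology *)

(** With W^-1 * W in U and N^-1 * N in V, a translate of W contains at most one
point of N, because two of them would differ by an element of U `&` V. *)
Lemma transversal_not_compact (G : groupType) (tau delta : Topological G) :
  transversal tau delta -> ~ compact [set: space tau].
Proof.
move=> [[tg _] [dg ndelta] disc] ctau.
have : nbhs (1 : topology_join tau delta) [set 1].
  by apply: open_nbhs_nbhs; split => //; exact: disc.
move=> /nbhs_join[U [V [U1 V1 UV1]]].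
have [W W1 WU] := nbhs1_divl tg U1.
have [N N1 NV] := nbhs1_divl dg V1.
have [|s _ scover] := @compact_nbhs_cover (space tau) _ G setT
    (fun x => [set y | W (x^-1 * y)]) ctau.
  by move=> x _; exists x => //; exact: nbhs_translate.
apply: (nonisolated1 dg ndelta); apply: (finite_nbhs_discrete dg N1).
(* The point of N in the translate x * W, if there is one. *)
pose g x := xget 1 [set y | N y /\ W (x^-1 * y)].
apply: (@sub_finite_set _ _ (g @` [set` s])); last first.
  exact/finite_image/finite_seq.
move=> v Nv; have [//|x xs Wxv] := scover v; exists x => //.
have [Ng Wg] : N (g x) /\ W (x^-1 * g x).
  by rewrite /g; case: xgetP => // /(_ v)[].
have /UV1 /= : (U `&` V) ((g x)^-1 * v).
  split; last exact: NV.
  by have := WU _ _ Wg Wxv; rewrite invgM invgK -mulgA mulVKg.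
by move=> /mulg1_eq; rewrite invgK.
Qed.

(** * Powers of one element *)

(** Weil's dichotomy for monothetic subgroups. If the powers of f return to each
neighbourhood of 1, then they do so with arbitrarily large exponents. By
compactness of K there is then a uniform N such that, from each power of f in
K, less than N backward steps lead to another power in K. So the first n for
which f ^+ (n + m) is in K is below N, whatever m is, and f ^+ m belongs to the
union of the sets f ^- n * K for n < N. *)
Lemma powers_sparse_or_bounded (G : groupType) (tau : Topological G) (f : G) :
  group_topology tau -> locally_compact [set: space tau] ->
  (exists2 U : set G, nbhs (1 : space tau) U &
    forall n, (0 < n)%N -> ~ U (f ^+ n)) \/
  (exists2 K : set G, compact (K : set (space tau)) & forall n, K (f ^+ n)).
Proof.
move=> tg lc; rewrite -implyNp => nsparse.
(* A return to the preimage of U under y |-> y ^+ m.+1 is a return to U whose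
   exponent is a positive multiple of m.+1. *)
have recur (U : set G) m :
    nbhs (1 : space tau) U -> exists2 n, (m < n)%N & U (f ^+ n).
  move=> U1; apply: contrapT => nU; apply: nsparse.
  exists [set y | U (y ^+ m.+1)]; first exact: nbhs1_expg.
  move=> n n0 /=; rewrite -expgnA => Un; apply: nU; exists (n * m.+1)%N => //.
  by rewrite leq_pmull.
have [K K1 cK] := locally_compact_nbhs (1 : space tau) lc.
have [V' V'1 V'K] := nbhs1_divl tg K1.
have [V V1 VV'] := nbhs1_divl tg V'1.
have [|s _ scover] := @compact_nbhs_cover (space tau) _ G setT
    (fun x => [set y | V (x^-1 * y)]) cK.
  by move=> x _; exists x => //; exact: nbhs_translate.
have [N0 N0gt0 VN0] := recur V' 0%N V'1.
(* Powers of f in x * V differ from a fixed one among them, f ^+ q, by an element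
   of V'; a further shift by the positive exponent N0 of a return to V' brings
   them into K. *)
pose J (x : G) := (N0 + xget 0 [set q : nat | V (x^-1 * f ^+ q)%g])%N.
pose N := (\max_(x <- s) J x).+1.
exists (\bigcup_(n in `I_N) [set x | K (f ^+ n * x)]).
  rewrite bigcup_mkord; apply: bigsetU_compact => n _.
  exact: (compact_translate tg).
move=> m.
have exn : exists n, `[< K (f ^+ (n + m)) >].
  have [n mn Kn] := recur K m K1; exists (n - m)%N; apply/asboolP.
  by rewrite subnK // ltnW.
case: (ex_minnP exn) => n /asboolP Kn nmin; exists n; last by rewrite /= -expgnDr.
have [x xs Vx] := scover _ Kn.
(* Going back J x steps from f ^+ (n + m) stays in K, so minimality of n forces
   n < J x. *)
have JN : (J x < N)%N by rewrite ltnS (big_rem x) //= leq_maxl.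
rewrite /=; apply: leq_ltn_trans JN; rewrite leqNgt; apply/negP => Jn.
suff /asboolP/nmin : K (f ^+ (n - J x + m)).
  by rewrite leqNgt ltn_subrL (leq_ltn_trans _ Jn) // andbT /J addn_gt0 N0gt0.
have -> : f ^+ (n - J x + m) =
    (f ^+ N0)^-1 * ((f ^+ (J x - N0))^-1 * f ^+ (n + m)).
  apply: (mulgI (f ^+ N0)); rewrite mulVKg.
  apply: (mulgI (f ^+ (J x - N0))); rewrite mulVKg -!expgnDr; congr (_ ^+ _).
  by rewrite addnA subnK ?leq_addr // addnA subnKC // ltnW.
apply: V'K => //; rewrite /J addKn.
case: xgetP => [q _ /= Vq|/(_ (n + m)%N)//].
by have := VV' _ _ Vq Vx; rewrite invgM invgK -mulgA mulVKg.
Qed.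

(** * Generation by finitely many central elements and a compact set *)

Lemma centerV (G : groupType) (z : G) : center z -> center z^-1.
Proof.
by move=> cz x; apply: commute_sym; apply: commuteV; exact/commute_sym.
Qed.

(** When s consists of central elements, this is the submonoid that they
generate. Writing it as a product of sets of powers makes it bounded as soon as
each factor is. *)
Definition power_products (G : groupType) (s : seq G) : set G :=
  foldr (fun f (P : set G) =>
    [set a * b | a in range (fun n : nat => f ^+ n) & b in P]) [set 1] s.

Lemma power_products1 (G : groupType) (s : seq G) : power_products s 1.
Proof.
by elim: s => //= f s IH; exists 1; [exists 0%N | exists 1 => //; rewrite mulg1].
Qed.

Lemma power_products_mulr (G : groupType) (s : seq G) (h z : G) :
  {in s, forall f, center f} -> z \in s ->
  power_products s h -> power_products s (h * z).
Proof.
elim: s h => //= f s IH h sZ; rewrite inE => zfs [_ [n _ <-] [b Pb <-]].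
have [->|zf] := eqVneq z f.
  exists (f ^+ n.+1); first by exists n.+1.
  exists b => //; rewrite expgSr -!mulgA; congr (_ * _).
  by apply: (sZ f); rewrite inE eqxx.
exists (f ^+ n); first by exists n.
rewrite -mulgA; exists (b * z) => //.
apply: IH => // [y ys|]; first by apply: (sZ y); rewrite inE ys orbT.
by move: zfs; rewrite (negPf zf).
Qed.

Lemma power_products_bounded (G : groupType) (tau : Topological G) (s : seq G) :
  group_topology tau ->
  {in s, forall f, exists2 K : set G,
    compact (K : set (space tau)) & forall n, K (f ^+ n)} ->
  exists2 K : set G, compact (K : set (space tau)) & power_products s `<=` K.
Proof.
move=> tg; elim: s => [|f s IH] sK.
  by exists [set 1] => //; exact: (@compact_set1 (space tau)).
have [|L cL sL] := IH; first by move=> g gs; apply: sK; rewrite inE gs orbT.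
have [|K cK fK] := sK f; first by rewrite inE eqxx.
exists [set a * b | a in K & b in L]; first exact: compact_mulg.
move=> _ [_ [n _ <-] [b Pb <-]]; exists (f ^+ n) => //.
by exists b => //; exact: sL.
Qed.

Section CentralCover.
Variables (G : groupType) (tau : Topological G).
Hypothesis tg : group_topology tau.

Lemma pi_center_quotientP (x y : G) :
  \pi_(center_quotient tau) x = \pi_(center_quotient tau) y <->
  center (x^-1 * y).
Proof.
split=> [xy|xy]; last by apply/eqmodP/asboolP.
have /eqmodP/asboolP // :
  x = y %[mod {eq_quot center_coset (tau := tau)}]%qT := xy.
Qed.

(** The projection to the quotient is open: the saturation of an open set is a
union of its translates. *)
Lemma nbhs_center_quotient (x : G) (U : set G) : nbhs (x : space tau) U ->
  nbhs (\pi_(center_quotient tau) x : center_quotient tau)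
    [set q | exists2 y : G, U y & q = \pi_(center_quotient tau) y].
Proof.
rewrite nbhsE => -[V [oV Vx] VU].
exists [set q | exists2 y : G, V y & q = \pi_(center_quotient tau) y]; split.
- rewrite /open /= /quotient_open.
  rewrite openE => y [v Vv]; move=> /pi_center_quotientP yv.
  have oV' : nbhs (y * (y^-1 * v) : space tau) V.
    by rewrite mulVKg; exact: open_nbhs_nbhs.
  rewrite /interior; apply: filterS (nbhs_mulgr tg oV') => w /= Vw.
  exists (w * (y^-1 * v)) => //.
  by apply/pi_center_quotientP; rewrite mulKg.
- by exists x.
- by move=> q [y /VU Uy ->]; exists y.
Qed.

(** A finite union K of translates of a compact neighbourhood U of 1 meets all
cosets of the center; C is K * U, so that the points of K are interior to it,
and 1 is put into K to make C a neighbourhood of 1. *)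
Lemma central_compact_cover : central_group tau ->
  exists C : set G, [/\ compact (C : set (space tau)), nbhs (1 : space tau) C &
    forall y : G, exists2 z : G, center z &
      nbhs (y : space tau) [set w | C (z^-1 * w)]].
Proof.
move=> [_ lc cq]; have [U U1 cU] := locally_compact_nbhs (1 : space tau) lc.
pose f (x : G) : set (center_quotient tau) :=
  [set q | exists2 y : G, U (x^-1 * y) & q = \pi_(center_quotient tau) y].
have [|s _ scover] := @compact_nbhs_cover (center_quotient tau) _ G setT f cq.
  move=> q _; exists (repr q) => //; rewrite -{1}[q]reprK.
  exact: nbhs_center_quotient (nbhs_translate tg _ U1).
pose K := [set 1] `|` \big[setU/set0]_(x <- s) [set y | U (x^-1 * y)].
have cK : compact (K : set (space tau)).
  apply: (@compactU (space tau)); first exact: compact_set1.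
  by apply: (@bigsetU_compact (space tau)) => x _; exact: compact_translate.
exists [set a * b | a in K & b in U]; split; first exact: compact_mulg.
  by apply: filterS U1 => y Uy; exists 1; [left | exists y => //; rewrite mul1g].
move=> y; have [//|x xs [v Uv /pi_center_quotientP yv]] :=
  scover (\pi_(center_quotient tau) y).
have Kv : K v by right; rewrite -bigcup_seq; exists x.
exists (y^-1 * v)^-1; first exact: centerV.
rewrite invgK; have := nbhs_translate tg y U1; apply: filterS => w /= Uw.
exists v => //; exists (y^-1 * w) => //.
(* As y^-1 * v is central, v = y * (y^-1 * v) = (y^-1 * v) * y. *)
by rewrite -{1}[v](mulVKg y) -(yv y) -mulgA mulVKg.
Qed.

(** S is the set of products of an element of [power_products s] and an element
of C. From C * C in F * C, where F is the set of entries of s, one gets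
S * C in S. As C is a neighbourhood of 1, this makes S open, and also closed: a
point in the closure of S lies in w * C for some w in S. *)
Lemma connected_central_generation (C : set G) :
  connected [set: space tau] -> compact (C : set (space tau)) ->
  nbhs (1 : space tau) C ->
  (forall y : G, exists2 z : G, center z &
    nbhs (y : space tau) [set w | C (z^-1 * w)]) ->
  exists2 s : seq G, {in s, forall z, center z} &
    forall x, exists2 h, power_products s h & C (h^-1 * x).
Proof.
move=> conn cC C1 Ccover; have C1' := nbhs_singleton C1.
have [|s sZ scover] := @compact_nbhs_cover (space tau) _ G (@center G)
    (fun z => [set w | C (z^-1 * w)]) (compact_mulg tg cC cC).
  by move=> x _; exact: Ccover.
exists s => // x.
pose S : set G := [set y | exists2 h, power_products s h & C (h^-1 * y)].
have SC y c : S y -> C c -> S (y * c).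
  move=> [h hs hy] Cc.
  have [|z zs Cz] := scover (h^-1 * y * c).
    by exists (h^-1 * y) => //; exists c.
  exists (h * z); first exact: power_products_mulr.
  by move: Cz; rewrite /= invgM !mulgA.
suff ST : S = [set: space tau] by have : S x by rewrite ST.
apply: conn.
- by exists 1; exists 1; [exact: power_products1 | rewrite mulVg].
- exists S; last by rewrite setTI.
  rewrite openE => y Sy; rewrite /interior.
  by apply: filterS (nbhs_translate tg y C1) => w /(SC y _ Sy); rewrite mulVKg.
- exists S; last by rewrite setTI.
  move=> y clSy.
  have : nbhs (y : space tau) [set w | C (w^-1 * y)].
    apply: (nbhs_invg tg (U := [set w | C (w * y)])).
    by apply: nbhs_mulgr => //; rewrite mulVg.
  by move=> /clSy[w [Sw Cw]]; have := SC _ _ Sw Cw; rewrite mulVKg.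
Qed.

End CentralCover.

(** Otherwise G = P * C with both P, the set of products of powers, and C inside
compact sets, and G would be compact. *)
Lemma exists_sparse_central_element (G : groupType) (tau : Topological G) :
  central_group tau -> connected [set: space tau] -> ~ compact [set: space tau] ->
  exists f : G, center f /\ exists2 U : set G, nbhs (1 : space tau) U &
    forall n, (0 < n)%N -> ~ U (f ^+ n).
Proof.
move=> cg conn nc; have [tg lc _] := cg.
have [C [cC C1 Ccover]] := central_compact_cover tg cg.
have [s sZ sG] := connected_central_generation tg conn cC C1 Ccover.
apply: contrapT => nsparse; apply: nc.
have [|K cK sK] := @power_products_bounded G tau s tg.
  move=> f fs; have [spf|//] := powers_sparse_or_bounded f tg lc.
  by case: nsparse; exists f; split=> //; exact: sZ.
have -> : [set: space tau] = [set a * b | a in K & b in C].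
  apply/seteqP; split=> // x _; have [h /sK Kh Ch] := sG x.
  by exists h => //; exists (h^-1 * x) => //; rewrite mulVKg.
exact: compact_mulg.
Qed.

(** * Topologies from decreasing sequences of central subgroups *)

Section FiltrationTopology.
Variables (G : groupType) (B : nat -> set G).

(** Asking for all m >= n makes these sets stable under intersection for an
arbitrary sequence B, so that the topology can be defined before B is assumed
to be decreasing; for decreasing B it suffices to look at m = n. *)
Definition filtration_open (O : set G) : Prop :=
  forall x : G, O x ->
    exists n, forall m, (n <= m)%N -> forall b : G, B m b -> O (x * b).

Let filtration_openT : filtration_open setT.
Proof. by move=> x _; exists 0%N. Qed.

Let filtration_openI : setI_closed filtration_open.
Proof.
move=> O P oO oP x [/oO[n On] /oP[m Pm]]; exists (maxn n m) => k.
by rewrite geq_max => /andP[nk mk] b Bb; split; [exact: (On k)|exact: (Pm k)].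
Qed.

Let filtration_open_bigU (I : Type) (O : I -> set G) :
  (forall i, filtration_open (O i)) -> filtration_open (\bigcup_i O i).
Proof.
move=> oO x [i _ /oO[n On]]; exists n => m nm b Bb.
by exists i => //; exact: (On m).
Qed.

Definition filtration_topology : Topological G :=
  Topological.class (HB.pack_for topologicalType G
    (isOpenTopological.Build G
      filtration_openT filtration_openI filtration_open_bigU)).

Hypothesis B_decr : forall n, B n.+1 `<=` B n.
Hypothesis B1 : forall n, B n 1.
Hypothesis B_divl : forall n a b, B n a -> B n b -> B n (a^-1 * b).
Hypothesis B_central : forall n, B n `<=` @center G.

Let BV n a : B n a -> B n a^-1.
Proof. by move=> Ba; rewrite -[_^-1]mulg1; exact: B_divl. Qed.

Let BM n a b : B n a -> B n b -> B n (a * b).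
Proof. by move=> /BV Ba Bb; rewrite -[a]invgK; exact: B_divl. Qed.

Lemma nbhs_filtration (x : G) (A : set G) :
  nbhs (x : space filtration_topology) A <->
  exists n, forall b, B n b -> A (x * b).
Proof.
split.
  rewrite nbhsE => -[O [oO Ox] OA]; have [n On] := oO x Ox.
  by exists n => b Bb; apply: OA; exact: (On n).
move=> [n An]; rewrite nbhsE.
exists [set y | exists2 b, B n b & y = x * b].
  split; last by exists 1; rewrite ?mulg1.
  move=> _ [b Bb ->]; exists n => m nm c Bc.
  exists (b * c); last by rewrite mulgA.
  apply: BM => //; move: m nm Bc.
  elim=> [|m IH]; first by rewrite leqn0 => /eqP ->.
  by rewrite leq_eqVlt => /predU1P[->//|]; rewrite ltnS => /IH h /B_decr.
by move=> _ [b Bb ->]; exact: An.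
Qed.

Lemma filtration_group_topology :
  (forall a, (forall n, B n a) -> a = 1) -> group_topology filtration_topology.
Proof.
move=> Bcap; split.
- move=> [x y] A /nbhs_filtration[n An].
  exists ([set z | B n (x^-1 * z)], [set z | B n (y^-1 * z)]).
    by split; apply/nbhs_filtration; exists n => b Bb /=; rewrite mulKg.
  move=> [u v] /= [Bu Bv].
  have := An _ (BM Bu Bv); congr A.
  by rewrite -mulgA (mulgA y) -(B_central Bu) -(mulgA _ y) mulVKg mulgA mulVKg.
- move=> x A /nbhs_filtration[n An]; apply/nbhs_filtration; exists n => b Bb /=.
  by rewrite invgM (B_central (BV Bb)); apply: An; exact: BV.
- move=> p q pq; suff /mulg1_eq : p^-1 * q = 1 by rewrite invgK.
  apply: Bcap => n.
  (* Two cosets of the subgroup B n that meet are equal. *)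
  have [||z [/= Bp Bq]] :=
      pq [set z | B n (p^-1 * z)] [set z | B n (q^-1 * z)].
  + by apply/nbhs_filtration; exists n => b Bb /=; rewrite mulKg.
  + by apply/nbhs_filtration; exists n => b Bb /=; rewrite mulKg.
  have := BM Bp (BV Bq).
  by rewrite invgM invgK -mulgA mulVKg.
Qed.

Lemma filtration_not_discrete :
  (forall n, exists2 b, B n b & b <> 1) -> ~ discrete (space filtration_topology).
Proof.
move=> Bnt disc.
have : nbhs (1 : space filtration_topology) [set 1].
  by apply: open_nbhs_nbhs; split=> //; exact: disc.
move=> /nbhs_filtration[n Bn]; have [b Bb] := Bnt n; apply.
by have := Bn b Bb; rewrite mul1g.
Qed.

Lemma filtration_join_discrete (tau : Topological G) (U : set G) :
  group_topology tau -> nbhs (1 : space tau) U -> U `&` B 0%N `<=` [set 1] ->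
  discrete (topology_join tau filtration_topology).
Proof.
move=> tg U1 UB A; rewrite openE => x Ax; apply/nbhs_join.
exists [set y | U (x^-1 * y)], [set y | B 0%N (x^-1 * y)]; split.
- exact: nbhs_translate.
- by apply/nbhs_filtration; exists 0%N => b Bb /=; rewrite mulKg.
- move=> y [/= Uy By]; have /mulg1_eq : x^-1 * y = 1 by exact: UB.
  by rewrite invgK => <-.
Qed.

End FiltrationTopology.

(** * The dyadic topology of a central element *)

(** The subgroup generated by f ^+ (2 ^ n): an element of it is a quotient of two
powers with natural exponents, written here without division. *)
Definition dyadic_powers (G : groupType) (f : G) (n : nat) : set G :=
  [set a | exists p q, a * f ^+ (2 ^ n * p) = f ^+ (2 ^ n * q)].

Section DyadicPowers.
Variables (G : groupType) (f : G).
Hypotheses (cf : center f) (f_inf : forall n, (0 < n)%N -> f ^+ n <> 1).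

Lemma dyadic_powers_decr n : dyadic_powers f n.+1 `<=` dyadic_powers f n.
Proof.
by move=> a [p [q]]; rewrite !expnSr -!mulnA => apq; exists (2 * p)%N, (2 * q)%N.
Qed.

Lemma dyadic_powers1 n : dyadic_powers f n 1.
Proof. by exists 0%N, 0%N; rewrite muln0 mulg1. Qed.

Lemma dyadic_powers_divl n a b :
  dyadic_powers f n a -> dyadic_powers f n b -> dyadic_powers f n (a^-1 * b).
Proof.
move=> [p [q apq]] [r [t brt]]; exists (r + q)%N, (t + p)%N.
rewrite !mulnDr !expgnDr mulgA -(mulgA a^-1) brt.
apply: (mulgI a); rewrite !mulgA mulgV mul1g -!expgnDr addnC expgnDr -apq.
by rewrite -!mulgA -!expgnDr; congr (_ * _ ^+ _); rewrite addnC.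
Qed.

Lemma dyadic_powers_central n : dyadic_powers f n `<=` @center G.
Proof.
move=> a [p [q apq]] x.
have cX k : commute (f ^+ k) x.
  by apply: commute_sym; apply: commuteX; apply: commute_sym; exact: cf.
have -> : a = f ^+ (2 ^ n * q) / f ^+ (2 ^ n * p) by rewrite -apq mulgK.
by apply: commute_sym; apply: commuteM; [|apply: commuteV]; apply: commute_sym.
Qed.

Lemma expg_inj_inf i j : f ^+ i = f ^+ j -> i = j.
Proof.
wlog ij : i j / (i <= j)%N.
  by move=> h fij; have [/h->|/ltnW/h h'] := leqP i j => //; exact/esym/h'.
move=> fij; apply/eqP; rewrite eqn_leq ij /= leqNgt -subn_gt0.
apply/negP => /f_inf; by apply; rewrite expgnFr // fij mulgV.
Qed.

(** If a * f ^+ p = f ^+ q, then membership in level n forces p = q modulo 2 ^ n,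
because f has infinite order; n = p + q leaves only p = q. *)
Lemma dyadic_powers_cap a : (forall n, dyadic_powers f n a) -> a = 1.
Proof.
move=> Ba; have [p [q]] := Ba 0%N; rewrite !mul1n => apq.
suff pq : p = q by apply: (mulIg (f ^+ p)); rewrite apq pq mul1g.
have [r [t]] := Ba (p + q)%N; set N := (2 ^ _)%N => art.
have : f ^+ (p + N * t) = f ^+ (q + N * r).
  by rewrite addnC expgnDr -art -mulgA -expgnDr addnC !expgnDr mulgA apq.
move=> /expg_inj_inf/(congr1 (modn^~ N)).
have ltN : (p + q < N)%N by exact: ltn_expl.
rewrite /= ![(_ + N * _)%N]addnC ![(N * _)%N]mulnC !modnMDl !modn_small //.
  by apply: leq_ltn_trans ltN; rewrite leq_addl.
by apply: leq_ltn_trans ltN; rewrite leq_addr.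
Qed.

Lemma dyadic_powers_nontrivial n : exists2 b, dyadic_powers f n b & b <> 1.
Proof.
exists (f ^+ (2 ^ n)); last by apply: f_inf; rewrite expn_gt0.
by exists 0%N, 1%N; rewrite muln0 muln1 mulg1.
Qed.

End DyadicPowers.

Lemma admits_transversal_of_sparse_central (G : groupType) (tau : Topological G)
    (f : G) (U : set G) :
  group_topology tau -> ~ discrete (space tau) -> center f ->
  nbhs (1 : space tau) U -> (forall n, (0 < n)%N -> ~ U (f ^+ n)) ->
  admits_transversal tau.
Proof.
move=> tg nd cf U1 Uf.
have f_inf n : (0 < n)%N -> f ^+ n <> 1.
  by move=> /Uf nU f1; apply: nU; rewrite f1; exact: (nbhs_singleton U1).
have B_decr := @dyadic_powers_decr G f.
have B1 := @dyadic_powers1 G f.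
have B_divl := @dyadic_powers_divl G f.
have B_central := dyadic_powers_central cf.
exists (filtration_topology (dyadic_powers f)); split.
- by [].
- split.
    by apply: (filtration_group_topology B_decr B1 B_divl B_central);
      exact: dyadic_powers_cap.
  apply: (filtration_not_discrete B_decr B1 B_divl).
  exact: dyadic_powers_nontrivial.
(* V lies in the intersection of U and its inverse, so that it misses the negative
   powers of f too. *)
have [V V1 VU] := nbhs1_divl tg U1; have V1' := nbhs_singleton V1.
apply: (filtration_join_discrete B_decr B1 B_divl tg V1).
move=> a [Va [p [q]]]; rewrite !mul1n => apq /=.
have Ua : U a by have := VU _ _ V1' Va; rewrite invg1 mul1g.
have UaV : U a^-1 by have := VU _ _ Va V1'; rewrite mulg1.
have [pq|qp|pq] := ltngtP p q.
- case: (Uf (q - p)%N); first by rewrite subn_gt0.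
  by rewrite expgnFr ?(ltnW pq) // -apq mulgK.
- case: (Uf (p - q)%N); first by rewrite subn_gt0.
  by rewrite expgnFr ?(ltnW qp) // -apq invgM mulVKg.
- by apply: (mulIg (f ^+ p)); rewrite apq pq mul1g.
Qed.

(** * Connected central groups *)

Theorem theorem5p2 (G : groupType) (tau : Topological G)
    (Gcentral : central_group tau) (Gconnected : connected [set: space tau]) :
  admits_transversal tau <-> ~ compact [set: space tau].
Proof.
split=> [[delta]|nc]; first exact: transversal_not_compact.
have [tg _ _] := Gcentral.
(* A connected discrete space has one point, hence is compact. *)
have nd : ~ discrete (space tau).
  move=> disc; apply: nc.
  suff <- : [set (1 : space tau)] = [set: space tau] by exact: compact_set1.
  apply: Gconnected; first by exists 1.
    by exists [set 1]; [exact: disc | rewrite setTI].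
  by exists [set 1]; [rewrite -openC; exact: disc | rewrite setTI].
have [f [cf [U U1 Uf]]] := exists_sparse_central_element Gcentral Gconnected nc.
exact: (admits_transversal_of_sparse_central tg nd cf U1 Uf).
Qed.
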